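(* Let $d\in\mathbb{N}$, let $\mathcal{B}(d)$ be the Borel $\sigma$-algebra of $\mathbb{R}^d$, let $\mathcal{P}=\mathcal{P}(\mathbb{R}^d,\mathcal{B}(d))$ be the convex set of probability measures on $(\mathbb{R}^d,\mathcal{B}(d))$, and let $\mu\in\mathcal{P}$ have a mean. Then the convex core of $\mu$ is $\operatorname{cc}(\mu)=m(F_{\mathcal{P}}(\mu))$. The relative algebraic interior of $\operatorname{cc}(\mu)$ is $\operatorname{rai}(\operatorname{cc}(\mu))=m(\operatorname{rai}(F_{\mathcal{P}}(\mu)))$, which equals $$\operatorname{rai}(\operatorname{cc}(\mu))=m\left(\left\{\lambda\in\mathcal{P}\ \middle|\ \lambda\equiv\mu,\ \exists c\in(1,\infty)\colon \tfrac{1}{c}\leq\tfrac{\mathrm{d}\lambda}{\mathrm{d}\mu}\leq c\ \ \mu\text{-almost surely}\right\}\right).$$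
   Context: The convex core $\operatorname{cc}(\mu)$ of $\mu\in\mathcal{P}$ is the intersection of all convex sets $C\in\mathcal{B}(d)$ of full measure $\mu(C)=\mu(\mathbb{R}^d)$. The mean of $\lambda\in\mathcal{P}$ is $m(\lambda)=\int_{\mathbb{R}^d}x\,\mathrm{d}\lambda(x)\in\mathbb{R}^d$, provided each coordinate function is $\lambda$-integrable; otherwise $\lambda$ does not have a mean. For a set $S$ of probability measures having means, $m(S)=\{m(\lambda):\lambda\in S\}$. $\lambda\ll\mu$ denotes absolute continuity (every $\mu$-null set is a $\lambda$-null set), $\lambda\equiv\mu$ means $\lambda\ll\mu$ and $\mu\ll\lambda$, and $\frac{\mathrm{d}\lambda}{\mathrm{d}\mu}$ is the Radon-Nikodym derivative. $\mathcal{P}$ is regarded as a convex subset of the real vector space of finite signed measures. For a convex subset $K$ of a real vector space, with $(x,y)=\{(1-\lambda)x+\lambda y:\lambda\in(0,1)\}$ and $[x,y]=\{(1-\lambda)x+\lambda y:\lambda\in[0,1]\}$, an extreme set of $K$ is a subset $E\subset K$ such that $[x,y]\subset E$ for all points $x\neq y$ in $K$ with $(x,y)\cap E\neq\emptyset$. A face of $K$ is a convex extreme set of $K$. For $x\in K$, $F_K(x)$ is the face of $K$ generated by $x$, i.e. the intersection of all faces of $K$ containing $x$. The relative algebraic interior $\operatorname{rai}(K)$ is the set of all points $x\in K$ such that for every line $g$ in the affine hull $\operatorname{aff}(K)$ containing $x$, the intersection $g\cap K$ includes an open segment (with distinct endpoints) containing $x$. *)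

(* Defs.v *)
From HB Require Import structures.
From mathcomp Require Import all_boot all_order all_algebra.
From mathcomp Require Import all_classical all_reals all_analysis.

Set Implicit Arguments.
Unset Strict Implicit.
Unset Printing Implicit Defensive.

Import Order.TTheory GRing.Theory Num.Theory.
Import numFieldNormedType.Exports.

Local Open Scope classical_set_scope.
Local Open Scope ring_scope.

Section convexity.
Context {R : realType} {V : lmodType R}.
Implicit Types (x y : V) (K E g : set V).

Definition open_segment x y : set V :=
  [set (1 - t) *: x + t *: y | t in `]0, 1[%classic].

Definition closed_segment x y : set V :=
  [set (1 - t) *: x + t *: y | t in `[0, 1]%classic].

Definition extreme_set K E : Prop :=
  E `<=` K /\
  forall x y, K x -> K y -> x != y ->
    open_segment x y `&` E !=set0 -> closed_segment x y `<=` E.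

Definition face K E : Prop :=
  convex_set (E : set (convex_lmodType V)) /\ extreme_set K E.

(* Only meaningful for [x] in [K]: otherwise the intersection is empty-indexed. *)
Definition face_generated K x : set V :=
  \bigcap_(E in [set E | face K E /\ E x]) E.

Definition affine_hull K : set V :=
  [set v | exists n (a : 'I_n -> R) (p : 'I_n -> V),
    [/\ forall i, K (p i), \sum_i a i = 1 & v = \sum_i a i *: p i]].

Definition is_line g : Prop :=
  exists x y, x != y /\ g = [set (1 - t) *: x + t *: y | t in [set: R]].

Definition rel_algebraic_interior K : set V :=
  [set x | K x /\
    forall g, is_line g -> g `<=` affine_hull K -> g x ->
      exists y z, [/\ y != z, open_segment y z x &
                      open_segment y z `<=` g `&` K]].

End convexity.

Section finite_signed_measures.
Context d (T : measurableType d) (R : realType).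

(* The values of a library charge on non-measurable sets are arbitrary, and its
   values are extended reals that are finite on measurable sets only. A finite
   signed measure is encoded as a real-valued set function that is zero outside
   the sigma-algebra and agrees with a charge on it; two of them are then equal
   iff they agree on measurable sets. *)
Definition is_signed_measure (f : set T -> R^o) : Prop :=
  (forall A, ~ measurable A -> f A = 0) /\
  exists nu : {charge set T -> \bar R},
    forall A, measurable A -> nu A = (f A)%:E.

Definition signed_measure_pred : {pred set T -> R^o} :=
  mem [set f | is_signed_measure f].

Record signed_measure := SignedMeasure {
  signed_measure_fun :> set T -> R^o ;
  _ : signed_measure_fun \in signed_measure_pred }.

HB.instance Definition _ := [isSub for signed_measure_fun].
HB.instance Definition _ := [Choice of signed_measure by <:].

Lemma signed_measure_submod_closed : submod_closed signed_measure_pred.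
Proof.
split.
  apply/mem_set; split=> //; exists czero => A mA //.
move=> a f g /set_mem[f0 [nf nfE]] /set_mem[g0 [ng ngE]].
apply/mem_set; split=> [A nmA|].
  by rewrite /GRing.add /GRing.scale /= f0// g0// scaler0 addr0.
exists (cadd (cscale a nf) ng) => A mA.
rewrite EFinD EFinM -(nfE _ mA) -(ngE _ mA) //.
Qed.

HB.instance Definition _ :=
  GRing.isSubmodClosed.Build _ _ signed_measure_pred
    signed_measure_submod_closed.

HB.instance Definition _ := [SubChoice_isSubLmodule of signed_measure by <:].

Lemma signed_measure_of_subproof (nu : {charge set T -> \bar R}) :
  (fun A => if `[< measurable A >] then fine (nu A) else 0) \in
    signed_measure_pred.
Proof.
apply/mem_set; split=> [A nmA|]; first by rewrite asboolF.
by exists nu => A mA; rewrite asboolT// fineK// fin_num_measure.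
Qed.

Definition signed_measure_of (nu : {charge set T -> \bar R}) : signed_measure :=
  SignedMeasure (signed_measure_of_subproof nu).

Definition signed_of_prob (P : probability T R) : signed_measure :=
  signed_measure_of (charge_of_finite_measure P).

Definition probability_measures : set signed_measure := range signed_of_prob.

End finite_signed_measures.

Notation borelRn R d := (g_sigma_algebraType (@open 'rV[R]_d)).

Section mean_and_core.
Context {R : realType} {d : nat}.
Implicit Types (P mu : probability (borelRn R d) R).
Implicit Types (S : set (signed_measure (borelRn R d) R)).

Definition has_mean P : Prop :=
  forall i : 'I_d, P.-integrable setT (fun x : 'rV[R]_d => (x ord0 i)%:E).

Definition mean P : 'rV[R]_d := \row_i \int[P]_x (x : 'rV[R]_d) ord0 i.

Definition have_means S : Prop :=
  S `<=` [set signed_of_prob P | P in [set P | has_mean P]].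

Definition mean_set S : set 'rV[R]_d :=
  [set mean P | P in [set P | S (signed_of_prob P)]].

Definition convex_core mu : set 'rV[R]_d :=
  \bigcap_(C in [set C : set (borelRn R d) |
      [/\ measurable C, convex_set (C : set (convex_lmodType 'rV[R]_d)) &
          mu C = mu setT]]) C.

End mean_and_core.

(* Main.v *)
Require Import Defs.
From HB Require Import structures.
From mathcomp Require Import all_boot all_order all_algebra.
From mathcomp Require Import all_classical all_reals all_analysis.
From mathcomp Require Import measurable_realfun ring lra.
Import Order.TTheory GRing.Theory Num.Theory.
Import numFieldNormedType.Exports.
Local Open Scope classical_set_scope.
Local Open Scope ring_scope.
Local Open Scope charge_scope.

(* The face of the probability measures generated by [mu] consists of the
   [lambda <= c mu], because such a [lambda] lies on a segment through [mu].
   In any convex set [K], a point [x] is in the relative algebraic interior iff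
   every segment from [y] in [K] to [x] can be prolonged beyond [x] inside [K];
   hence the interior of the face consists of the [lambda] with, moreover,
   [mu <= c lambda], and it is mapped by the affine map [mean] onto the interior of
   the image.
   A point [x] outside a convex set [M] of R^d is separated from it by a
   lexicographic cone: finitely many linear forms such that, for all [y] in [M],
   the first form that does not vanish at [y - x] is positive there. Lexicographic
   cones and their complements are Borel and convex, and they contain the mean of
   every probability measure carried by them, by induction on the number of forms.
   Thus means of [lambda <= c mu] belong to all convex Borel sets of full measure;
   conversely, if [x] is not such a mean, the lexicographic cone at [x] that contains
   the set of all these means has full measure, as otherwise [mu] conditioned on its
   complement would have its mean there. *)

(** * Relative algebraic interiors *)

Section convexity.
Context {R : realType} {V : lmodType R}.
Implicit Types (x y : V) (K : set V).

Lemma convex_setP K : convex_set (K : set (convex_lmodType V)) <->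
  forall x y (t : R), K x -> K y -> 0 <= t <= 1 -> K ((1 - t) *: x + t *: y).
Proof.
split=> [cK x y t Kx Ky t01|cK x y l /set_mem Kx /set_mem Ky].
  have := cK y x (Itv01 (andP t01).1 (andP t01).2) (mem_set Ky) (mem_set Kx).
  by move/set_mem; rewrite /conv/= addrC.
apply/mem_set; rewrite /conv/= addrC; apply: cK => //.
by apply/andP; split.
Qed.

Lemma sub_affine_hull K x y t : K x -> K y ->
  affine_hull K ((1 - t) *: x + t *: y).
Proof.
move=> Kx Ky; exists 2%N, (fun i => if i == ord0 then 1 - t else t),
  (fun i => if i == ord0 then x else y); split.
- by move=> i; case: ifP.
- by rewrite big_ord_recl big_ord1 /= subrK.
- by rewrite big_ord_recl big_ord1 /=.
Qed.

(** Solving for [x] gives the weight [e / (1 + e)]: a prolongation beyond [x] becomes a convex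
    combination equal to [x], the form to which affinity of [mean] applies. *)
Lemma extrapolationP x y z (e : R) : 0 < e ->
  x + e *: (x - y) = z <-> x = (1 - e / (1 + e)) *: z + (e / (1 + e)) *: y.
Proof.
move=> e0; have e1 : 1 + e != 0 by rewrite gt_eqF// addr_gt0.
split=> [<-|xE].
  have te : (1 - e / (1 + e)) * e = e / (1 + e) by field.
  by rewrite scalerDr scalerA te scalerBr addrA subrK -scalerDl subrK scale1r.
rewrite scalerBr addrA -[X in X + _ - _]scale1r -scalerDl xE.
rewrite scalerDr !scalerA (mulrC (1 + e) (e / _)) divfK// addrK.
by rewrite [X in X *: _](_ : _ = 1) ?scale1r//; field.
Qed.

(** For convex [K] containing [x] these directions form a convex cone, so an affine combination can
    be treated term by term. *)
Definition feasible K x : set V := [set w | exists2 e : R, 0 < e & K (x + e *: w)].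

Lemma feasible_add K x w1 w2 : convex_set (K : set (convex_lmodType V)) ->
  feasible K x w1 -> feasible K x w2 -> feasible K x (w1 + w2).
Proof.
move=> /convex_setP cK [e1 e1gt0 K1] [e2 e2gt0 K2].
have egt0 : 0 < e1 + e2 by apply: addr_gt0.
(* At this step length a convex combination of the two given points has equal coefficients on both
   directions. *)
exists (e1 * e2 / (e1 + e2)); first by rewrite divr_gt0// mulr_gt0.
have -> : x + (e1 * e2 / (e1 + e2)) *: (w1 + w2) =
    (1 - e1 / (e1 + e2)) *: (x + e1 *: w1) + (e1 / (e1 + e2)) *: (x + e2 *: w2).
  rewrite !scalerDr !scalerA addrACA -scalerDl subrK scale1r.
  by congr (_ + (_ *: _ + _ *: _)); field; rewrite gt_eqF.
apply: cK => //; apply/andP; split; first by rewrite divr_ge0 ?ltW.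
by rewrite ler_pdivrMr// mul1r lerDl ltW.
Qed.

Lemma feasible_scale K x w a : K x -> 0 <= a ->
  feasible K x w -> feasible K x (a *: w).
Proof.
move=> Kx; rewrite le_eqVlt => /predU1P[<- _|agt0 [e egt0 Kxw]].
  by exists 1 => //; rewrite scale0r scaler0 addr0.
by exists (e / a); rewrite ?divr_gt0// scalerA divfK// gt_eqF.
Qed.

(** The line through [x] and [y] yields a point beyond [x]. Conversely, for [w] in the affine hull,
    [w - x] is a combination of directions [b i - x], each feasible together with its opposite, so
    every line of the affine hull through [x] has room on both sides. *)
Lemma rel_algebraic_interiorE K : convex_set (K : set (convex_lmodType V)) ->
  rel_algebraic_interior K =
    [set x | K x /\ forall y, K y -> exists2 e : R, 0 < e & K (x + e *: (x - y))].
Proof.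
move=> cvxK; have /convex_setP cK := cvxK; apply/seteqP; split=> x [Kx xint].
  split=> // y Ky; have [->|neyx] := eqVneq y x.
    by exists 1 => //; rewrite subrr scaler0 addr0.
  have linexy : is_line [set (1 - t) *: x + t *: y | t in [set: R]].
    by exists x, y; rewrite eq_sym.
  have [||y' [z' [neyz [t t01 xE] yzK]]] := xint _ linexy.
  - by move=> _ [t _ <-]; exact: sub_affine_hull.
  - by exists 0 => //; rewrite subr0 scale1r scale0r addr0.
  move: t01; rewrite /= in_itv/= => /andP[t_gt0 t_lt1].
  (* Shifting the parameter [t] by [u] either way stays inside the open segment, hence inside
     [K]. *)
  pose u := Num.min t (1 - t) / 2.
  have u_gt0 : 0 < u by rewrite divr_gt0// lt_min t_gt0 subr_gt0.
  have ult : u < t /\ u < 1 - t.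
    have ult : u < Num.min t (1 - t).
      by rewrite ltr_pdivrMr// ltr_pMr ?ltr1n// lt_min t_gt0 subr_gt0.
    by move: ult; rewrite lt_min => /andP[].
  have seg s : `|s| <= u -> open_segment y' z' (x + s *: (z' - y')).
    move=> su; exists (t + s).
      rewrite /= in_itv/=; move: su; rewrite ler_norml => /andP[]; case: ult.
      by move=> *; apply/andP; split; lra.
    rewrite -xE scalerBr opprD addrA scalerBl [(t + s) *: z']scalerDl addrACA.
    by congr (_ + _); rewrite addrC.
  have uu : `|u| <= u by rewrite ger0_norm // ltW.
  have [[r _ rE] Kp] := yzK _ (seg u uu).
  have [|_ Km] := yzK _ (seg (- u) _); first by rewrite normrN.
  have {}rE : u *: (z' - y') = r *: (y - x).
    apply: (addrI x); rewrite -rE scalerBl scale1r scalerBr.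
    by rewrite -addrA; congr (_ + _); rewrite addrC.
  (* The sign of [r] tells which of the two shifted points lies beyond [x] as seen from [y]; [r = 0]
     would force [y' = z']. *)
  case: (ltgtP r 0) => [r0|r0|r0].
  - exists (- r); first by rewrite oppr_gt0.
    by rewrite -(opprB y x) scalerN scaleNr opprK -rE.
  - by exists r => //; rewrite -(opprB y x) scalerN -rE -scaleNr.
  - move: rE; rewrite r0 scale0r => /eqP; rewrite scaler_eq0 gt_eqF//= subr_eq0.
    by move/eqP => zy; rewrite zy eqxx in neyz.
split=> // g [p [q [nepq gE]]] gaff gx.
have feas w : affine_hull K w -> feasible K x (w - x) /\ feasible K x (x - w).
  move=> [n [a [b [Kb a1 ->]]]].
  have xE : x = \sum_i a i *: x by rewrite -scaler_suml a1 scale1r.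
  have feas1 i : feasible K x (b i - x) /\ feasible K x (x - b i).
    split; last exact: xint.
    by exists 1 => //; rewrite scale1r addrC subrK.
  have feas0 : feasible K x 0 by exists 1 => //; rewrite scaler0 addr0.
  have -> : \sum_i a i *: b i - x = \sum_i a i *: (b i - x).
    by rewrite [in LHS]xE -sumrB; apply: eq_bigr => i _; rewrite scalerBr.
  have -> : x - \sum_i a i *: b i = \sum_i a i *: (x - b i).
    by rewrite [in LHS]xE -sumrB; apply: eq_bigr => i _; rewrite scalerBr.
  have feas_sum (F : 'I_n -> V) :
      (forall i, feasible K x (F i)) -> feasible K x (\sum_i F i).
    by move=> FK; elim/big_ind: _ => // *; exact: feasible_add.
  (* A negative coefficient turns a direction into its opposite, which is feasible as well. *)
  split; apply: feas_sum => i; case: (leP 0 (a i)) => [a0|/ltW a0].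
  - by apply: feasible_scale => //; exact: (feas1 i).1.
  - rewrite -[a i]opprK scaleNr -scalerN opprB.
    by apply: feasible_scale; rewrite ?oppr_ge0//; exact: (feas1 i).2.
  - by apply: feasible_scale => //; exact: (feas1 i).2.
  - rewrite -[a i]opprK scaleNr -scalerN opprB.
    by apply: feasible_scale; rewrite ?oppr_ge0//; exact: (feas1 i).1.
move: (gx); rewrite {1}gE => -[t0 _ t0E].
have gline s : g (x + s *: (q - p)).
  rewrite gE; exists (t0 + s) => //; rewrite -t0E opprD addrA [in RHS]scalerBr.
  rewrite scalerBl [(t0 + s) *: q]scalerDl -!addrA; congr (_ + _).
  by rewrite addrCA; congr (_ + _); rewrite addrC.
have [] := feas _ (gaff _ (gline 1)).
rewrite scale1r addrAC subrr add0r opprD addrA subrr add0r.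
move=> [e1 e1gt0 K1] [e2 e2gt0 K2].
have egt0 : 0 < e1 + e2 by apply: addr_gt0.
exists (x + e1 *: (q - p)), (x + e2 *: - (q - p)); split.
- apply/eqP => /addrI; rewrite scalerN => /eqP; rewrite -subr_eq0 opprK -scalerDl.
  by rewrite scaler_eq0 gt_eqF//= subr_eq0 eq_sym (negbTE nepq).
- exists (e1 / (e1 + e2)).
    by rewrite /= in_itv/= divr_gt0//= ltr_pdivrMr// mul1r ltrDl.
  move: (q - p) => w.
  rewrite !scalerDr addrACA -scalerDl subrK scale1r !scalerN !scalerA.
  rewrite -scalerBl [X in X *: _](_ : _ = 0) ?scale0r ?addr0//.
  by field; rewrite gt_eqF.
- move=> _ [t + <-]; rewrite /= in_itv/= => /andP[t_gt0 t_lt1]; split; last first.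
    by apply: cK => //; rewrite !ltW.
  move: gline; move: (q - p) => w gline.
  rewrite !scalerDr addrACA -scalerDl subrK scale1r.
  by rewrite !scalerN !scalerA -scalerBl; exact: gline.
Qed.

End convexity.

(** * Lexicographic separation *)

Section blunt_cone.
Context {R : realType} {V : lmodType R}.
Implicit Types (v w : V) (P : set V).

(** The positive cone of a strict partial order compatible with the vector space structure. *)
Definition blunt_cone P := [/\ ~ P 0,
  forall v w, P v -> P w -> P (v + w) &
  forall (a : R) v, 0 < a -> P v -> P (a *: v)].

(** Zorn's lemma gives a maximal cone; if it contained neither [v] nor [- v] for some nonzero [v],
    the ray of [v] could be adjoined. *)
Lemma maximal_blunt_cone P : blunt_cone P ->
  exists Q, [/\ P `<=` Q, blunt_cone Q & forall v, [\/ v = 0, Q v | Q (- v)]].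
Proof.
move=> [P0 PD PZ].
(* The union with [P] is built into the property, so that the union of the empty chain is admissible
   too. *)
have [|Q [cQ maxQ]] := @Zorn_bigcup V [set Q | blunt_cone (P `|` Q)].
  move=> F FP Ftot; split.
  - by move=> [//|[X FX X0]]; have [+ _ _] := FP _ FX; apply; right.
  - have PFD v w X : P v -> F X -> X w -> (P `|` \bigcup_(X in F) X) (v + w).
      move=> Pv FX Xw; have [_ /(_ v w) XD _] := FP _ FX.
      by case: XD; [left|right|left|right; exists X].
    move=> v w [Pv|[X FX Xv]] [Pw|[Y FY Yw]].
    + by left; exact: PD.
    + exact: PFD Yw.
    + by rewrite addrC; exact: PFD Xv.
    + wlog XY : v w X Y FX FY Xv Yw / X `<=` Y.
        move=> wl; have [XY|YX] := Ftot _ _ FX FY; first exact: (wl v w X Y).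
        by rewrite addrC; exact: (wl w v Y X).
      have [_ /(_ v w) YD _] := FP _ FY.
      by case: YD; [right; exact: XY|right|left|right; exists Y].
  - move=> a v a0 [Pv|[X FX Xv]]; first by left; exact: PZ.
    have [_ _ /(_ a v a0) XZ] := FP _ FX.
    by case: XZ; [right|left|right; exists X].
pose S := P `|` Q.
exists S; split => //; first exact: subsetUl.
have [S0 SD SZ] := cQ.
move=> v; apply: contrapT => nor.
have v0 : v <> 0 by move=> v0; apply: nor; constructor 1.
have nSv : ~ S v by move=> Sv; apply: nor; constructor 2.
have nSNv : ~ S (- v) by move=> SNv; apply: nor; constructor 3.
have Sv a w : 0 < a -> S w -> w + a *: v != 0.
  move=> a0 Sw; apply/eqP => /eqP; rewrite addr_eq0 => /eqP wE; apply: nSNv.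
  have -> : - v = a^-1 *: w by rewrite wE scalerN scalerA mulVf ?gt_eqF// scale1r.
  by apply: SZ; rewrite ?invr_gt0.
(* The cone generated by [S] and [v] without its apex: [w = 0] demands a positive multiple of
   [v]. *)
pose T := [set u | exists2 a : R, 0 <= a & exists2 w, S w \/ (w = 0 /\ 0 < a) &
  u = w + a *: v].
have ST : S `<=` T.
  by move=> w Sw; exists 0 => //; exists w; [left|rewrite scale0r addr0].
have Tv : T v.
  by exists 1 => //; exists 0; [right; split|rewrite scale1r add0r].
apply: (maxQ T).
  split; first by apply: subset_trans ST; exact: subsetUr.
  by move=> /(_ v Tv) Qv; apply: nSv; right.
rewrite /= (_ : P `|` T = T); last first.
  by apply/setUidPr => w Pw; apply: ST; left.
split.
- move=> [a a0 [w [Sw|[-> {}a0]]]].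
    move: a0; rewrite le_eqVlt => /predU1P[<-|a0].
      by rewrite scale0r addr0 => w0; apply: S0; rewrite w0.
    by move=> /esym/eqP; apply/negP; exact: Sv.
  by rewrite add0r => /esym/eqP; rewrite scaler_eq0 gt_eqF//= => /eqP.
- move=> _ _ [a a0 [w Sw ->]] [b b0 [z Sz ->]].
  exists (a + b); first exact: addr_ge0.
  exists (w + z); last by rewrite addrACA scalerDl.
  case: Sw => [Sw|[-> {}a0]]; case: Sz => [Sz|[-> {}b0]]; rewrite ?addr0 ?add0r.
  + by left; exact: SD.
  + by left.
  + by left.
  + by right; rewrite addr_gt0.
- move=> b _ b0 [a a0 [w Sw ->]].
  exists (b * a); first by rewrite mulr_ge0// ltW.
  exists (b *: w); last by rewrite scalerDr scalerA.
  case: Sw => [Sw|[-> {}a0]]; first by left; exact: SZ.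
  by right; rewrite scaler0 mulr_gt0.
Qed.

End blunt_cone.

Section lexicographic.
Context {R : realType} {d : nat}.
Implicit Types (x y v : 'rV[R]_d) (c : 'cV[R]_d) (fs : seq 'cV[R]_d).

Definition dot v c : R := (v *m c) ord0 ord0.

Lemma dotD v w c : dot (v + w) c = dot v c + dot w c.
Proof. by rewrite /dot mulmxDl mxE. Qed.

Lemma dotZ a v c : dot (a *: v) c = a * dot v c.
Proof. by rewrite /dot -scalemxAl mxE. Qed.

Lemma dotN v c : dot (- v) c = - dot v c.
Proof. by rewrite /dot mulNmx mxE. Qed.

Fixpoint lexpos fs v : Prop :=
  if fs is c :: fs' then 0 < dot v c \/ dot v c = 0 /\ lexpos fs' v else False.

Lemma lexpos0 fs : ~ lexpos fs 0.
Proof.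
by elim: fs => //= c fs IH [|[]//]; rewrite /dot mul0mx mxE ltxx.
Qed.

(* [P] is the positive cone of a total order on the vector space. The sum [u] of the
   absolute values of the rows of [W] is an order unit of the row space of [W], and
   the linear form is [v |-> sup {t | t u < v}]. *)
Lemma blunt_cone_functional (P : set 'rV[R]_d) (W : 'M[R]_d) :
  blunt_cone P -> (forall v, [\/ v = 0, P v | P (- v)]) -> W != 0 ->
  exists c, (W *m c != 0) /\ forall v, (v <= W)%MS -> P v -> 0 <= dot v c.
Proof.
move=> [P0 PD PZ] Ptot W0.
pose Pge v := v = 0 \/ P v.
have PgeD v w : Pge v -> Pge w -> Pge (v + w).
  move=> [->|Pv] [->|Pw]; rewrite ?addr0 ?add0r; [left|right|right|right] => //.
  exact: PD.
have PgeZ a v : 0 <= a -> Pge v -> Pge (a *: v).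
  rewrite le_eqVlt => /predU1P[<- _|a0 [->|Pv]].
  - by left; rewrite scale0r.
  - by left; rewrite scaler0.
  - by right; exact: PZ.
have PDge v w : P v -> Pge w -> P (v + w).
  by move=> Pv [->|Pw]; [rewrite addr0|exact: PD].
pose absP v := if `[< P v >] then v else - v.
have Pabs v : Pge (absP v).
  rewrite /absP; case: asboolP => [|nPv]; first by right.
  by case: (Ptot v) => [->| |]; [left; rewrite oppr0| |right].
have absle (a b : R) v : `|b| <= a -> Pge (a *: absP v - b *: v).
  rewrite ler_norml => /andP[ba1 ba2]; have := Pabs v.
  rewrite /absP; case: asboolP => _ Pv.
    by rewrite -scalerBl; apply: PgeZ => //; lra.
  rewrite -[X in _ - b *: X]opprK [b *: _]scalerN opprK -scalerDl.
  by apply: PgeZ => //; lra.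
pose u := \sum_i absP (row i W).
have [i0 rowi0] : exists i, row i W != 0.
  apply: contrapT => /forallNP rW0; move/eqP: W0; apply; apply/row_matrixP => i.
  by rewrite row0; apply/eqP/negP => /negP; exact: rW0.
have Pu : P u.
  rewrite /u (bigD1 i0)//=; apply: PDge.
    case: (Pabs (row i0 W)) => // absP0; exfalso; move: rowi0.
    move: absP0; rewrite /absP; case: ifPn => _ /eqP; rewrite ?oppr_eq0 => ->//.
  by elim/big_ind: _ => //; left.
have uunit v : (v <= W)%MS -> exists M : R, P (M *: u - v).
  move=> /submxP[b ->]; pose M := \sum_i `|b ord0 i|.
  (* [M] bounds each coefficient of [v]; the additional [u] makes the inequality strict. *)
  exists (M + 1); rewrite scalerDl scale1r addrAC addrC; apply: PDge => //.
  rewrite mulmx_sum_row /u scaler_sumr -sumrB.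
  elim/big_ind: _ => //; first by left.
  move=> i _; apply: absle; rewrite /M (bigD1 i)//= lerDl sumr_ge0//.
(* The supremum is described as a two-sided cut, a form symmetric under negation from which
   linearity follows directly. *)
pose isval v r := (forall t, t < r -> P (v - t *: u)) /\
                  (forall t, r < t -> P (t *: u - v)).
have P_anti v : P v -> P (- v) -> False.
  by move=> Pv PNv; apply: P0; rewrite -(subrr v); exact: PD.
have uN (t : R) : P (t *: u) -> 0 < t.
  move=> Ptu; rewrite ltNge; apply/negP; rewrite le_eqVlt => /predU1P[t0|t0].
    by move: Ptu; rewrite t0 scale0r.
  apply: (P_anti (t *: u)) => //; rewrite -scaleNr; apply: PZ => //.
  by rewrite oppr_gt0.
have val_le v r1 r2 : isval v r1 -> isval v r2 -> r1 <= r2.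
  move=> [lt1 _] [_ gt2]; rewrite leNgt; apply/negP => r21.
  apply: (P_anti (v - ((r1 + r2) / 2) *: u)); first by apply: lt1; lra.
  by rewrite opprB; apply: gt2; lra.
have val_uniq v r1 r2 : isval v r1 -> isval v r2 -> r1 = r2.
  by move=> v1 v2; apply/eqP; rewrite eq_le !(val_le v).
have valP v : (v <= W)%MS -> exists r, isval v r.
  move=> vW; have [M1 vM1] := uunit _ vW.
  have [M2 vM2] : exists M, P (M *: u - - v) by apply: uunit; rewrite eqmx_opp.
  pose S := [set t : R | P (v - t *: u)].
  have Sdown s t : s < t -> S t -> S s.
    move=> st St; have -> : S s = P (v - t *: u + (t - s) *: u).
      by rewrite /S/= scalerBl addrA subrK.
    by apply: PD => //; apply: PZ => //; rewrite subr_gt0.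
  have Ssup : has_sup S.
    split; first by exists (- M2); rewrite /S /= scaleNr opprK addrC -[v]opprK.
    exists M1 => t St; rewrite leNgt; apply/negP => M1t.
    have : S M1 by exact: Sdown St.
    by move=> /P_anti; apply; rewrite opprB.
  exists (sup S); split=> t.
    by move=> /(sup_gt Ssup.1)[s Ss ts]; exact: Sdown Ss.
  move=> supt; have nSt : ~ S t.
    by move=> /(ub_le_sup Ssup.2); rewrite leNgt supt.
  have [s /andP[sups st]] : exists s, sup S < s < t.
    by exists ((sup S + t) / 2); apply/andP; split; lra.
  case: (Ptot (v - t *: u)) => [vt|//|]; last by rewrite opprB.
  exfalso; have : S s.
    rewrite /S /= (_ : v = t *: u) ?(subr0_eq vt)// -scalerBl.
    by apply: PZ => //; rewrite subr_gt0.
  by move=> /(ub_le_sup Ssup.2); rewrite leNgt sups.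
have valD v w r s : isval v r -> isval w s -> isval (v + w) (r + s).
  move=> [v1 v2] [w1 w2]; split=> t rst.
    have -> : v + w - t *: u = (v - (r - (r + s - t) / 2) *: u) +
                             (w - (s - (r + s - t) / 2) *: u).
      rewrite addrACA -opprD -scalerDl; congr (_ - _ *: _); lra.
    by apply: PD; [apply: v1|apply: w1]; lra.
  have -> : t *: u - (v + w) = ((r + (t - r - s) / 2) *: u - v) +
                             ((s + (t - r - s) / 2) *: u - w).
    rewrite addrACA -opprD -scalerDl; congr (_ *: _ - _); lra.
  by apply: PD; [apply: v2|apply: w2]; lra.
have valN v r : isval v r -> isval (- v) (- r).
  move=> [v1 v2]; split=> t rt.
    have -> : - v - t *: u = (- t) *: u - v by rewrite scaleNr addrC.
    by apply: v2; rewrite ltrNr.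
  have -> : t *: u - - v = v - (- t) *: u by rewrite scaleNr !opprK addrC.
  by apply: v1; rewrite ltrNl.
have val0 : isval 0 0.
  split=> t t0; last by rewrite subr0; exact: PZ.
  by rewrite add0r -scaleNr; apply: PZ; rewrite ?oppr_gt0.
have valZ a v r : isval v r -> isval (a *: v) (a * r).
  move=> vr; wlog a0 : a v r vr / 0 < a => [wl|].
    case: (ltgtP a 0) => [a0|a0|->]; [|exact: wl|by rewrite scale0r mul0r].
    by rewrite -[a]opprK scaleNr mulNr; apply/valN/wl => //; rewrite oppr_gt0.
  case: vr => v1 v2; split=> t tr.
    have -> : a *: v - t *: u = a *: (v - (t / a) *: u).
      by rewrite scalerBr scalerA mulrCA divff ?mulr1// gt_eqF.
    by apply: PZ => //; apply: v1; rewrite ltr_pdivrMr// mulrC.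
  have -> : t *: u - a *: v = a *: ((t / a) *: u - v).
    by rewrite scalerBr scalerA mulrCA divff ?mulr1// gt_eqF.
  by apply: PZ => //; apply: v2; rewrite ltr_pdivlMr// mulrC.
have [g gP] : exists g : 'I_d -> R, forall i, isval (row i W) (g i).
  have /choice[g gP] i : exists r, isval (row i W) r by apply: valP; exact: row_sub.
  by exists g.
(* For [v] in the row space, [v *m pinvmx W] lists coefficients of [v] over the rows of [W], so
   [dot v c] combines the row values [g i] with them. *)
pose c := pinvmx W *m \col_i g i.
have cP v : (v <= W)%MS -> isval v (dot v c).
  move=> vW; rewrite -{1}(mulmxKpV vW) /c /dot (mulmxA v (pinvmx W)).
  move: (v *m pinvmx W) => b; rewrite mulmx_sum_row mxE.
  elim/big_ind2: _ => // [*|i _]; first exact: valD.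
  by rewrite mxE; exact: valZ.
exists c; split=> [|v vW Pv].
  have uW : (u <= W)%MS.
    rewrite /u; apply: summx_sub => i _; rewrite /absP; case: ifP => _.
      exact: row_sub.
    by rewrite eqmx_opp row_sub.
  (* Since [u] has value 1, the form cannot vanish on the row space of [W]. *)
  have u1 : isval u 1.
    split=> t t1; [rewrite -[X in X - _]scale1r|rewrite -[X in _ - X]scale1r];
      by rewrite -scalerBl; apply: PZ => //; rewrite subr_gt0.
  apply/eqP => Wc0; have := val_uniq _ _ _ u1 (cP _ uW).
  move/submxP: uW => [b ->]; rewrite /dot -mulmxA Wc0 mulmx0 mxE.
  by move/eqP; rewrite oner_eq0.
have [_ vlt] := cP _ vW; rewrite leNgt; apply/negP => c0.
(* A negative value would put a negative multiple of [u] above the positive [v], against [uN]. *)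
have /PD/(_ Pv) : P ((dot v c / 2) *: u - v) by apply: vlt; lra.
by rewrite subrK => /uN; lra.
Qed.

(** Induction on the rank of a subspace: a form nonnegative on the cone there decides the vectors
    outside its kernel, and the kernel meets the subspace in smaller rank. *)
Lemma blunt_cone_lexpos (P : set 'rV[R]_d) :
  blunt_cone P -> (forall v, [\/ v = 0, P v | P (- v)]) ->
  exists fs, P `<=` lexpos fs.
Proof.
move=> cP Ptot; have [P0 _ _] := cP.
suff : forall n (W : 'M[R]_d), (\rank W <= n)%N ->
    exists fs, forall v, (v <= W)%MS -> P v -> lexpos fs v.
  move=> /(_ d 1%:M (rank_leq_row _))[fs fsP]; exists fs => v.
  by apply: fsP; exact: submx1.
elim=> [|n IH] W rW.
  exists [::] => v; move: rW; rewrite leqn0 mxrank_eq0 => /eqP ->.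
  by rewrite submx0 => /eqP ->.
have [W0|W0] := eqVneq W 0; first by apply: IH; rewrite W0 mxrank0.
have [c [Wc cpos]] := blunt_cone_functional _ _ cP Ptot W0.
have [|fs fsP] := IH (W :&: kermx c)%MS.
  rewrite -ltnS (leq_trans _ rW)//; apply: rank_ltmx.
  rewrite ltmxE capmxSl sub_capmx submx_refl/=; apply/negP => /sub_kermxP Wc0.
  by rewrite Wc0 eqxx in Wc.
exists (c :: fs) => v vW Pv /=; have := cpos _ vW Pv.
rewrite le_eqVlt => /predU1P[c0|]; [right; split=> //|by left].
apply: fsP => //; rewrite sub_capmx vW; apply/sub_kermxP.
by apply/matrixP => i j; rewrite !ord1 [RHS]mxE c0.
Qed.

(** As [x] is not in [M], the cone spanned by the differences [y - x] omits 0; it extends to the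
    positive cone of a total order, whose elements are lexicographically positive. *)
Lemma convex_set_lexpos (M : set 'rV[R]_d) x :
  convex_set (M : set (convex_lmodType 'rV[R]_d)) -> ~ M x ->
  exists fs, forall y, M y -> lexpos fs (y - x).
Proof.
move=> /convex_setP cM nMx.
pose P := [set v | exists2 a : R, 0 < a & exists2 y, M y & v = a *: (y - x)].
have cP : blunt_cone P.
  split.
  - move=> [a a0 [y My /esym/eqP]]; rewrite scaler_eq0 gt_eqF//= subr_eq0.
    by move=> /eqP yx; apply: nMx; rewrite -yx.
  - move=> _ _ [a a0 [y My ->]] [b b0 [z Mz ->]].
    have ab0 : 0 < a + b by exact: addr_gt0.
    exists (a + b) => //; exists ((1 - b / (a + b)) *: y + (b / (a + b)) *: z).
      apply: cM => //; apply/andP; split; first by rewrite divr_ge0// ltW.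
      by rewrite ler_pdivrMr// mul1r lerDr ltW.
    rewrite !scalerBr scalerDr !scalerA addrACA -opprD -scalerDl.
    by congr (_ *: _ + _ *: _ - _); field; rewrite gt_eqF.
  - move=> b _ b0 [a a0 [y My ->]]; exists (b * a); first exact: mulr_gt0.
    by exists y => //; rewrite scalerA.
have [Q [PQ cQ Qtot]] := maximal_blunt_cone _ cP.
have [fs fsQ] := blunt_cone_lexpos _ cQ Qtot.
exists fs => y My; apply/fsQ/PQ; exists 1 => //; exists y => //.
by rewrite scale1r.
Qed.

End lexicographic.

(** * Faces of the set of probability measures *)

Section probability_of_signed.
Context d (T : measurableType d) (R : realType) (s : signed_measure T R).
Hypotheses (s_ge0 : forall A, 0 <= s A) (s_setT : s setT = 1).

(** The hypotheses are arguments so that the measure and probability instances, which depend on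
    them, can be attached to the function. *)
Definition probability_of_signed & (forall A, 0 <= s A) & s setT = 1 :
  set T -> \bar R := fun A => (s A)%:E.

Local Notation p := (probability_of_signed s_ge0 s_setT).

Let nu_ex : exists nu : {charge set T -> \bar R},
  forall A, measurable A -> nu A = (s A)%:E.
Proof. by case: (s) => f pf; case: (set_mem pf). Qed.

Let p0 : p set0 = 0%E.
Proof. by have [nu nuE] := nu_ex; rewrite /p -nuE// charge0. Qed.

Let p_ge0 A : (0 <= p A)%E.
Proof. by rewrite lee_fin. Qed.

Let p_sigma_additive : semi_sigma_additive p.
Proof.
have [nu nuE] := nu_ex.
move=> F mF tF mUF; rewrite /p -nuE//.
under eq_fun do under eq_bigr do rewrite -nuE//.
exact: charge_semi_sigma_additive.
Qed.

HB.instance Definition _ := isMeasure.Build _ _ _ p p0 p_ge0 p_sigma_additive.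

Let p_setT : p setT = 1%E.
Proof. by rewrite /p s_setT. Qed.

HB.instance Definition _ := Measure_isProbability.Build _ _ _ p p_setT.

End probability_of_signed.
Arguments probability_of_signed {d T R s}.

Section signed_measures.
Context d (T : measurableType d) (R : realType).
Implicit Types (s m : signed_measure T R) (P mu : probability T R) (A : set T).

Lemma signed_measureDE s m A : (s + m) A = s A + m A.
Proof. by []. Qed.

Lemma signed_measureZE (a : R) s A : (a *: s) A = a * s A.
Proof. by []. Qed.

Lemma signed_measureNE s A : (- s) A = - s A.
Proof. by []. Qed.

Lemma signed_measure_eq s m : (forall A, measurable A -> s A = m A) -> s = m.
Proof.
move=> sm; apply/val_inj/funext => A.
have [mA|nA] := pselect (measurable A); first exact: sm.
case: s m {sm} => [s ps] [m pm] /=.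
by have [-> //] := set_mem ps; have [-> //] := set_mem pm.
Qed.

Lemma signed_of_probE P A : measurable A -> (signed_of_prob P A)%:E = P A.
Proof. by move=> mA; rewrite /= asboolT// fineK// fin_num_measure. Qed.

(** Values on non-measurable sets are 0, so nonnegativity can be asked of all sets and later
    inequalities carry no measurability conditions. *)
Lemma probability_measuresP s :
  probability_measures s <-> (forall A, 0 <= s A) /\ s setT = 1.
Proof.
split=> [[P _ <-]|[s0 s1]].
  split=> [A|]; first by rewrite /=; case: ifP => // _; apply/fine_ge0.
  by apply/EFin_inj; rewrite signed_of_probE// probability_setT.
exists (probability_of_signed s0 s1) => //; apply: signed_measure_eq => A mA.
exact/EFin_inj/signed_of_probE.
Qed.

Lemma convex_probability_measures :
  convex_set (@probability_measures _ T R : set (convex_lmodType _)).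
Proof.
apply/convex_setP => s m t /probability_measuresP[s0 s1].
move=> /probability_measuresP[m0 m1] /andP[t0 t1].
apply/probability_measuresP; split=> [A|].
  by rewrite /= addr_ge0// mulr_ge0// subr_ge0.
by rewrite signed_measureDE !signed_measureZE s1 m1; lra.
Qed.

(** A bounded density expressed on sets: such bounds are linear in the measures and avoid null
    sets. *)
Definition dominated m : set (signed_measure T R) :=
  [set s | probability_measures s /\ exists2 c : R, 0 < c & forall A, s A <= c * m A].

Definition equivalent m : set (signed_measure T R) :=
  [set s | dominated m s /\ exists2 c : R, 0 < c & forall A, m A <= c * s A].

Lemma dominated_refl m : probability_measures m -> dominated m m.
Proof. by move=> pm; split => //; exists 1 => // A; rewrite mul1r. Qed.

Lemma convex_dominated m : probability_measures m ->
  convex_set (dominated m : set (convex_lmodType _)).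
Proof.
move=> /probability_measuresP[m0 _]; apply/convex_setP => s1 s2 t.
move=> [ps1 [c1 c1gt0 s1c]] [ps2 [c2 c2gt0 s2c]] t01; split.
  by move/convex_setP: convex_probability_measures; exact.
exists (c1 + c2) => [|A]; first exact: addr_gt0.
rewrite signed_measureDE !signed_measureZE; have := m0 A; case/andP: t01.
have := s1c A; have := s2c A.
have : s1 A <= (c1 + c2) * m A.
  by rewrite (le_trans (s1c A))// ler_wpM2r// lerDl ltW.
have : s2 A <= (c1 + c2) * m A.
  by rewrite (le_trans (s2c A))// ler_wpM2r// lerDr ltW.
move=> ? ? _ _ ? ? _; nra.
Qed.

(** Each summand of a convex combination with positive weights is at most a multiple of the
    combination, because the other summand is nonnegative. *)
Lemma face_dominated m : probability_measures m ->
  face (@probability_measures _ T R) (dominated m).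
Proof.
move=> pm; split; first exact: convex_dominated.
have /probability_measuresP[m0 _] := pm.
split=> [s []//|x y px py _ [z [[t t01 xyz] [_ [c cgt0 zc]]]]].
move: t01; rewrite /= in_itv/= => /andP[t_gt0 t_lt1].
have /probability_measuresP[x0 _] := px.
have /probability_measuresP[y0 _] := py.
have t1 : 0 < 1 - t by rewrite subr_gt0.
have xm : dominated m x.
  split=> //; exists (c / (1 - t)) => [|A]; first exact: divr_gt0.
  rewrite mulrAC ler_pdivlMr// (le_trans _ (zc A))// -xyz.
  by rewrite signed_measureDE !signed_measureZE mulrC lerDl mulr_ge0// ltW.
have ym : dominated m y.
  split=> //; exists (c / t) => [|A]; first exact: divr_gt0.
  rewrite mulrAC ler_pdivlMr// (le_trans _ (zc A))// -xyz.
  by rewrite signed_measureDE !signed_measureZE mulrC lerDr mulr_ge0// ltW.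
move=> _ [r /= + <-]; rewrite in_itv/= => r01.
by move/convex_setP: (convex_dominated _ pm); exact.
Qed.

(* If [s <= c m] then [m] lies strictly between [s] and the probability measure
   [(c m - s) / (c - 1)]. *)
Lemma face_generatedE m : probability_measures m ->
  face_generated (@probability_measures _ T R) m = dominated m.
Proof.
move=> pm; apply/seteqP; split=> s.
  by apply; split; [exact: face_dominated|exact: dominated_refl].
move=> [ps [c0 c0gt0 sc0]] E [[_ [_ extE]] Em].
have /probability_measuresP[m0 m1] := pm.
have /probability_measuresP[s0 s1] := ps.
(* Enlarging the constant by 1 makes the divisor [c - 1] positive. *)
pose c := c0 + 1; have c1 : 0 < c - 1 by rewrite addrK.
have c_gt0 : 0 < c by exact: addr_gt0.
have sc A : s A <= c * m A.
  by rewrite (le_trans (sc0 A))// ler_wpM2r// lerDl.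
pose z := (c - 1)^-1 *: (c *: m - s).
have pz : probability_measures z.
  apply/probability_measuresP; split=> [A|].
    rewrite signed_measureZE mulr_ge0 ?invr_ge0 ?(ltW c1)//.
    by rewrite signed_measureDE signed_measureNE signed_measureZE subr_ge0.
  rewrite signed_measureZE signed_measureDE signed_measureNE signed_measureZE.
  by rewrite m1 s1 mulr1 mulVf// gt_eqF.
have mE : (1 - (c - 1) / c) *: s + ((c - 1) / c) *: z = m.
  apply: signed_measure_eq => A mA.
  rewrite signed_measureDE !signed_measureZE signed_measureDE signed_measureNE.
  by rewrite signed_measureZE; field; rewrite !gt_eqF.
have [sz|sz] := eqVneq s z.
  suff -> : s = m by [].
  by rewrite -mE -sz -scalerDl subrK scale1r.
apply: (extE s z ps pz sz).
  exists m; split => //; exists ((c - 1) / c) => //.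
  by rewrite /= in_itv/= divr_gt0//= ltr_pdivrMr// mul1r gtrDl ltrN10.
exists 0; first by rewrite /= in_itv/= lexx ler01.
by rewrite subr0 scale1r scale0r addr0.
Qed.

(** Prolonging from [m] through [s] makes [(1 + e) s - e m] nonnegative, which bounds [m] by a
    multiple of [s]. Conversely, such a bound makes every [y] in the face at most a multiple of [s],
    so a small multiple of [y] can be subtracted from [s]. *)
Lemma rel_algebraic_interior_dominated m : probability_measures m ->
  rel_algebraic_interior (dominated m) = equivalent m.
Proof.
move=> pm; rewrite rel_algebraic_interiorE; last exact: convex_dominated.
have /probability_measuresP[m0 m1] := pm.
apply/seteqP; split=> s [ds sint]; split => //.
  have [e e0 [/probability_measuresP[w0 _] _]] := sint _ (dominated_refl _ pm).
  exists ((1 + e) / e) => [|A]; first by rewrite divr_gt0// addr_gt0.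
  have := w0 A; rewrite signed_measureDE signed_measureZE signed_measureDE.
  rewrite signed_measureNE mulrAC ler_pdivlMr//; lra.
move=> y [py [c1 c1gt0 yc]]; case: sint => c2 c2gt0 ms.
have [ps [c3 c3gt0 sc]] := ds.
have /probability_measuresP[s0 s1] := ps.
have /probability_measuresP[y0 y1] := py.
have ys A : y A <= (c1 * c2) * s A.
  by rewrite (le_trans (yc A))// -mulrA ler_wpM2l// ltW.
have c12 : 0 < c1 * c2 by exact: mulr_gt0.
exists (c1 * c2)^-1; first by rewrite invr_gt0.
have le_s A : (c1 * c2)^-1 * y A <= s A.
  by rewrite mulrC ler_pdivrMr// mulrC.
split.
  apply/probability_measuresP; split=> [A|].
    rewrite signed_measureDE signed_measureZE signed_measureDE signed_measureNE.
    have := le_s A; have : 0 <= (c1 * c2)^-1 * s A.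
      by rewrite mulr_ge0// invr_ge0 ltW.
    lra.
  rewrite signed_measureDE signed_measureZE signed_measureDE signed_measureNE.
  by rewrite s1 y1 subrr mulr0 addr0.
exists ((1 + (c1 * c2)^-1) * c3) => [|A].
  by rewrite mulr_gt0// addr_gt0// invr_gt0.
rewrite signed_measureDE signed_measureZE signed_measureDE signed_measureNE.
have : 0 <= (c1 * c2)^-1 * y A by rewrite mulr_ge0// invr_ge0 ltW.
have : (1 + (c1 * c2)^-1) * s A <= (1 + (c1 * c2)^-1) * (c3 * m A).
  by rewrite ler_wpM2l// addr_ge0// invr_ge0 ltW.
lra.
Qed.

End signed_measures.
Arguments dominated {d T R}.
Arguments equivalent {d T R}.

(** * Density bounds *)

Section density_bounds.
Local Open Scope ereal_scope.
Context d (T : measurableType d) (R : realType).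
Implicit Types (f g : T -> \bar R).

(** Where [g] is negative, the integral of its absolute value is minus that of [g], hence zero, so
    [g] vanishes almost everywhere there. *)
Lemma integral_ge0_ae (mu : {measure set T -> \bar R}) g :
  mu.-integrable setT g ->
  (forall A, measurable A -> 0 <= \int[mu]_(x in A) g x) ->
  {ae mu, forall x, 0 <= g x}.
Proof.
move=> intg g0; have mg := measurable_int _ intg.
pose N := [set x | g x < 0].
have mN : measurable N.
  by rewrite /N -[X in measurable X]setTI; exact: measurable_lte.
have intNg : mu.-integrable N g by exact: (integrableS measurableT).
have : ae_eq mu N g (cst 0).
  apply/ae_eq_integral_abs => //; first exact: measurable_int intNg.
  apply/eqP; rewrite eq_le integral_ge0// andbT.
  rewrite (eq_integral (fun x => (-1)%:E * g x)).
    by rewrite integralZl// EFinN mulN1e oppe_le0 g0.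
  by move=> x /set_mem gx0; rewrite EFinN mulN1e lte0_abs.
apply: filterS => x gN; rewrite leNgt; apply/negP => gx0.
by move: (gx0); rewrite gN// ltxx.
Qed.

Lemma ae_le_integralP (mu : {measure set T -> \bar R}) f g :
  mu.-integrable setT f -> mu.-integrable setT g ->
  (forall x, f x \is a fin_num) ->
  {ae mu, forall x, f x <= g x} <->
  forall A, measurable A -> \int[mu]_(x in A) f x <= \int[mu]_(x in A) g x.
Proof.
move=> intf intg ffin.
have intS A h : measurable A -> mu.-integrable setT h -> mu.-integrable A h.
  by move=> mA; exact: integrableS.
split=> [[N [mN N0 fgN]] A mA|fg].
  rewrite (negligible_integral mN _ _ N0)//; last exact: intS.
  rewrite [leRHS](negligible_integral mN _ _ N0)//; last exact: intS.
  apply: le_integral; [exact: measurableD|apply: intS => //; exact: measurableD..|].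
  move=> x /set_mem[_ nNx]; apply: contrapT => nfg; apply: nNx; exact: fgN.
suff : {ae mu, forall x, 0 <= (g \- f) x}.
  by apply: filterS => x; rewrite /= sube_ge0 ?ffin// orbT.
apply: integral_ge0_ae => [|A mA]; first exact: integrableB.
rewrite integralB//; [|exact: intS..].
by rewrite sube_ge0 ?fg// integrable_fin_num// ?orbT//; exact: intS.
Qed.

End density_bounds.

Section density_class.
Context d (T : measurableType d) (R : realType).
Implicit Types (la mu : probability T R).

Lemma signed_of_prob_leP la mu (c : R) : 0 <= c ->
  (forall A, signed_of_prob la A <= c * signed_of_prob mu A) <->
  forall A, measurable A -> (la A <= c%:E * mu A)%E.
Proof.
move=> c0; split=> lamu A => [mA|].
  by rewrite -!signed_of_probE// -EFinM lee_fin.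
have [mA|nA] := pselect (measurable A).
  by rewrite -lee_fin EFinM !signed_of_probE//; exact: lamu.
by rewrite /= !asboolF// mulr0.
Qed.

(** Integrating the derivative and the constants over arbitrary measurable sets translates between
    setwise and almost sure bounds. *)
Lemma equivalent_density la mu :
  equivalent (signed_of_prob mu) (signed_of_prob la) <->
  [/\ la `<< mu, mu `<< la & exists c : R, 1 < c /\ {ae mu, forall x,
    ((c^-1)%:E <= ('d (charge_of_finite_measure la) '/d mu) x <= c%:E)%E}].
Proof.
have intc (c : R) : mu.-integrable setT (cst c%:E).
  exact: finite_measure_integrable_cst.
have RNint : la `<< mu ->
    mu.-integrable setT ('d (charge_of_finite_measure la) '/d mu).
  by move=> lamu; exact: Radon_Nikodym_integrable.
split=> [[[_ [c1 c1gt0 lamu]] [c2 c2gt0 mula]]|[lamu mula [c [c1 aec]]]].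
  move/signed_of_prob_leP : lamu => /(_ (ltW c1gt0)) lamu.
  move/signed_of_prob_leP : mula => /(_ (ltW c2gt0)) mula.
  have dlamu : la `<< mu.
    apply/null_content_dominatesP => A mA muA; apply/eqP.
    by rewrite -measure_le0 (le_trans (lamu A mA))// muA mule0.
  have dmula : mu `<< la.
    apply/null_content_dominatesP => A mA laA; apply/eqP.
    by rewrite -measure_le0 (le_trans (mula A mA))// laA mule0.
  (* The sum exceeds both constants, and the summand 1 ensures [1 < c]. *)
  split => //; pose c := c1 + c2 + 1; have c_gt1 : 1 < c by rewrite ltrDr addr_gt0.
  have c_gt0 : 0 < c by exact: lt_trans c_gt1.
  exists c; split => //.
  have h1 : {ae mu, forall x,
      (('d (charge_of_finite_measure la) '/d mu) x <= c%:E)%E}.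
    apply/ae_le_integralP => [||x|A mA]; [exact: RNint|exact: intc| |].
      exact: Radon_Nikodym_fin_num.
    rewrite -Radon_Nikodym_integral// integral_cst//.
    rewrite (le_trans (lamu A mA))// lee_wpmul2r// lee_fin /c; lra.
  have h2 : {ae mu, forall x,
      ((c^-1)%:E <= ('d (charge_of_finite_measure la) '/d mu) x)%E}.
    apply/ae_le_integralP => [||//|A mA]; [exact: intc|exact: RNint|].
    rewrite -Radon_Nikodym_integral// integral_cst//.
    rewrite lee_pdivrMl// (le_trans (mula A mA))// lee_wpmul2r// lee_fin /c; lra.
  by apply: filterS2 h1 h2 => x *; apply/andP; split.
have c_gt0 : 0 < c by exact: lt_trans c1.
have ffin x : 'd (charge_of_finite_measure la) '/d mu x \is a fin_num.
  exact: Radon_Nikodym_fin_num.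
have laE A : measurable A ->
    la A = (\int[mu]_(x in A) ('d (charge_of_finite_measure la) '/d mu) x)%E.
  by move=> mA; rewrite -Radon_Nikodym_integral.
split; [split; [by exists la|]|]; exists c => //; move=> B; move: B;
  apply/(signed_of_prob_leP _ _ _ (ltW c_gt0)) => A mA.
  rewrite -integral_cst//.
  rewrite laE//.
  move: A mA; apply/ae_le_integralP; [exact: RNint|exact: intc|exact: ffin|].
  by apply: filterS aec => x /andP[].
rewrite -lee_pdivrMl// -integral_cst//.
rewrite laE//.
move: A mA; apply/ae_le_integralP; [by []|exact: RNint|by []|].
by apply: filterS aec => x /andP[].
Qed.

End density_class.

(** * Means *)

Section integral_signed_of_prob.
Context d (T : measurableType d) (R : realType).
Implicit Types (P mu : probability T R).

Lemma dominated_integrable mu P (f : T -> \bar R) :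
   dominated (signed_of_prob mu) (signed_of_prob P) ->
  mu.-integrable setT f -> P.-integrable setT f.
Proof.
move=> [_ [c cgt0 Pmu]] /integrableP[mf intf]; apply/integrableP; split => //.
move/signed_of_prob_leP : Pmu => /(_ (ltW cgt0)) Pmu.
apply: (@le_lt_trans _ _ (\int[mscale (NngNum (ltW cgt0)) mu]_x `|f x|)%E).
  apply: ge0_le_measure_integral => //.
  exact: measurableT_comp.
rewrite ge0_integral_mscale//; last exact: measurableT_comp.
by rewrite lte_mul_pinfty// lee_fin ltW.
Qed.

Lemma ge0_integral_conv P P1 P2 (t : R) (f : T -> \bar R) : 0 <= t <= 1 ->
  signed_of_prob P = (1 - t) *: signed_of_prob P1 + t *: signed_of_prob P2 ->
  measurable_fun setT f -> (forall x, 0 <= f x)%E ->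
  (\int[P]_x f x = (1 - t)%:E * \int[P1]_x f x + t%:E * \int[P2]_x f x)%E.
Proof.
move=> /andP[t0 t1] PE mf f0; have t1' : 0 <= 1 - t by rewrite subr_ge0.
rewrite (eq_measure_integral (measure_add (mscale (NngNum t1') P1)
                                          (mscale (NngNum t0) P2))).
  by rewrite ge0_integral_measure_add// !ge0_integral_mscale.
move=> A mA _; rewrite [RHS]measure_addE -[LHS]/(P A) -signed_of_probE// PE.
by rewrite signed_measureDE !signed_measureZE EFinD !EFinM !signed_of_probE.
Qed.

Lemma Rintegral_conv P P1 P2 (t : R) (f : T -> R) : 0 <= t <= 1 ->
  signed_of_prob P = (1 - t) *: signed_of_prob P1 + t *: signed_of_prob P2 ->
  P1.-integrable setT (EFin \o f) -> P2.-integrable setT (EFin \o f) ->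
  \int[P]_x f x = (1 - t) * \int[P1]_x f x + t * \int[P2]_x f x.
Proof.
move=> t01 PE if1 if2; have mf := measurable_int _ if1.
have conv g := ge0_integral_conv _ _ _ _ g t01 PE.
rewrite /Rintegral (integralE P) (integralE P1) (integralE P2).
rewrite !conv//; [|exact: measurable_funeneg|exact: measurable_funepos].
have := integrable_pos_fin_num measurableT if1.
have := integrable_neg_fin_num measurableT if1.
have := integrable_pos_fin_num measurableT if2.
have := integrable_neg_fin_num measurableT if2.
move=> /fineK <- /fineK <- /fineK <- /fineK <-.
rewrite -!EFinM -!EFinD /=; ring.
Qed.

(** The witness is [mu] conditioned on [B], with domination constant the inverse of [mu B]. *)
Lemma conditional_dominated mu (B : set T) :
  measurable B -> mu B != 0%E ->
  exists2 P, dominated (signed_of_prob mu) (signed_of_prob P) & P (~` B) = 0%E.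
Proof.
move=> mB B0; have Bfin : mu B \is a fin_num by exact: fin_num_measure.
have Bgt0 : 0 < fine (mu B) by rewrite fine_gt0// lt0e B0 measure_ge0 ltey_eq Bfin.
pose P : probability T R := mnormalize (mrestr mu mB) mu.
have PE (A : set T) : P A = (mu (A `&` B) * (fine (mu B))^-1%:E)%E.
  (* Normalization has a default branch for zero or infinite mass, excluded here by [B0] and
     [Bfin]. *)
  have -> : P A = (if (mu (setT `&` B) == 0%E) || (mu (setT `&` B) == +oo%E)
      then fun U => mu U
      else fun U => mu (U `&` B) * (fine (mu (setT `&` B)))^-1%:E)%E A by [].
  by rewrite setTI (negbTE B0)/=; case: eqP => // Boo; rewrite Boo in Bfin.
exists P; last by rewrite PE setICl measure0 mul0e.
split; first by exists P.
exists (fine (mu B))^-1; first by rewrite invr_gt0.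
apply/signed_of_prob_leP; first by rewrite invr_ge0 ltW.
move=> A mA; rewrite PE muleC lee_wpmul2l//.
  by rewrite lee_fin invr_ge0 ltW.
by rewrite le_measure ?inE//; exact: measurableI.
Qed.

End integral_signed_of_prob.

Section means.
Context {R : realType} {d : nat}.
Implicit Types (P mu : probability (borelRn R d) R).
Implicit Types (x v : 'rV[R]_d) (c : 'cV[R]_d) (fs : seq 'cV[R]_d).

Lemma mean_conv P P1 P2 (t : R) : 0 <= t <= 1 ->
  signed_of_prob P = (1 - t) *: signed_of_prob P1 + t *: signed_of_prob P2 ->
  has_mean P1 -> has_mean P2 ->
  mean P = (1 - t) *: mean P1 + t *: mean P2.
Proof.
move=> t01 PE mP1 mP2; apply/rowP => i; rewrite !mxE.
by apply: Rintegral_conv; [| |exact: mP1|exact: mP2].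
Qed.

Lemma dotB_sum x v c : (dot (x - v) c)%:E =
  (\sum_(i < d) (c i ord0)%:E * (x ord0 i)%:E - (dot v c)%:E)%E.
Proof.
rewrite dotD dotN EFinB; congr (_ - _)%E.
rewrite /dot mxE -sumEFin; apply: eq_bigr => i _.
by rewrite mulrC EFinM.
Qed.

Lemma integrable_dot P v c : has_mean P ->
  P.-integrable setT (fun x : borelRn R d => (dot (x - v) c)%:E).
Proof.
move=> mP; under eq_fun do rewrite dotB_sum.
apply: integrableB => //; last exact: finite_measure_integrable_cst.
by apply: integrable_sum => // i _; exact: integrableZl.
Qed.

Lemma integral_dot P v c : has_mean P ->
  (\int[P]_x (dot ((x : 'rV[R]_d) - v) c)%:E = (dot (mean P - v) c)%:E)%E.
Proof.
move=> mP; under eq_integral do rewrite dotB_sum.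
rewrite integralB//; last 2 first.
- by apply: integrable_sum => // i _; exact: integrableZl.
- exact: finite_measure_integrable_cst.
rewrite integral_cst// -[X in (_ * X)%E]/(P setT) probability_setT mule1.
rewrite dotB_sum; congr (_ - _)%E.
rewrite integral_sum//; last by move=> i; exact: integrableZl.
apply: eq_bigr => i _; rewrite integralZl// mxE /Rintegral fineK//.
exact: integrable_fin_num.
Qed.

(** For an affine form nonnegative almost everywhere, the integral of its absolute value equals its
    value at the mean. *)
Lemma mean_dot_ge0 P v c : has_mean P ->
  {ae P, forall x : borelRn R d, 0 <= dot (x - v) c} ->
  0 <= dot (mean P - v) c /\
  (dot (mean P - v) c = 0 -> {ae P, forall x : borelRn R d, dot (x - v) c = 0}).
Proof.
move=> mP ae0; have intf := integrable_dot _ v c mP.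
have mf := measurable_int _ intf.
have intE : (\int[P]_x `|(dot ((x : 'rV[R]_d) - v) c)%:E| =
    (dot (mean P - v) c)%:E)%E.
  rewrite -integral_dot//; apply: ae_eq_integral => //.
  - exact: measurableT_comp.
  - by apply: filterS ae0 => x x0 _; rewrite gee0_abs.
split; first by rewrite -lee_fin -intE integral_ge0.
move=> mean0; have : ae_eq P setT (fun x : borelRn R d => (dot (x - v) c)%:E) (cst 0%E).
  by apply/ae_eq_integral_abs; rewrite ?intE ?mean0.
by apply: filterS => x /(_ I)[].
Qed.

(** The first form is nonnegative at the mean; if it is zero there, it vanishes almost everywhere
    and the remaining forms decide. Without forms the whole space would be null. *)
Lemma mean_lexpos P v fs : has_mean P ->
  {ae P, forall x : borelRn R d, lexpos fs (x - v)} -> lexpos fs (mean P - v).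
Proof.
move=> mP; elim: fs => [[N [mN N0 NT]]|c fs IH ae_pos].
  have : P N = P setT by congr (P _); apply/seteqP; split => // x _; apply: NT => /=.
  by rewrite N0 probability_setT => /esym/eqP; rewrite onee_eq0.
have [|ge0 eq0] := mean_dot_ge0 _ v c mP.
  by apply: filterS ae_pos => x /= [/ltW//|[->]].
move: (ge0); rewrite le_eqVlt => /predU1P[/esym mean0|]; [right|by left].
split => //; apply: IH; apply: filterS2 ae_pos (eq0 mean0) => x /= + x0.
by rewrite x0 ltxx => -[//|[]].
Qed.

(** The same induction, with the first form negated. *)
Lemma mean_not_lexpos P v fs : has_mean P ->
  {ae P, forall x : borelRn R d, ~ lexpos fs (x - v)} -> ~ lexpos fs (mean P - v).
Proof.
move=> mP; elim: fs => [_ []|c fs IH ae_neg] /=.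
have dotNr x : dot x (- c) = - dot x c by rewrite /dot mulmxN mxE.
have [|ge0 eq0] := mean_dot_ge0 _ v (- c) mP.
  apply: filterS ae_neg => x /= /not_orP[+ _]; rewrite dotNr oppr_ge0.
  by move/negP; rewrite -leNgt.
move: ge0; rewrite dotNr oppr_ge0 leNgt => /negP mean_le [//|[mean0]].
apply: IH; move: eq0; rewrite dotNr mean0 oppr0 => /(_ erefl) eq0.
apply: filterS2 ae_neg eq0 => x /= + /eqP; rewrite dotNr oppr_eq0 => + /eqP x0.
by move=> /not_orP[_ /not_andP[//|]].
Qed.

(* [has_mean mu] provides the measurability of the coordinates. *)
Lemma measurable_lexpos mu v fs : has_mean mu ->
  measurable [set x : borelRn R d | lexpos fs (x - v)].
Proof.
move=> mmu; elim: fs => [|c fs IH] /=; first exact: measurable0.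
have mf := measurable_int _ (integrable_dot _ v c mmu).
have m1 : measurable [set x : borelRn R d | (0%:E < (dot (x - v) c)%:E)%E].
  by rewrite -[X in measurable X]setTI; exact: measurable_lte.
have m2 : measurable [set x : borelRn R d | (dot (x - v) c)%:E = 0%:E].
  have := mf measurableT [set 0%:E] (emeasurable_set1 _).
  by rewrite setTI.
rewrite (_ : [set _ | _] = [set x : borelRn R d | (0%:E < (dot (x - v) c)%:E)%E] `|`
  ([set x : borelRn R d | (dot (x - v) c)%:E = 0%:E] `&`
   [set x : borelRn R d | lexpos fs (x - v)])).
  by apply: measurableU => //; exact: measurableI.
apply/seteqP; split=> x /=; rewrite lte_fin.
  by move=> [|[-> ?]]; [left|right].
by move=> [|[[->] ?]]; [left|right].
Qed.

Lemma lexpos_conv fs (v w : 'rV[R]_d) (t : R) : 0 <= t <= 1 ->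
  lexpos fs v -> lexpos fs w -> lexpos fs ((1 - t) *: v + t *: w).
Proof.
move=> /andP[t0 t1] fv fw.
(* The endpoints are treated apart: with both weights positive, one strictly positive leading value
   suffices. *)
move: t0; rewrite le_eqVlt => /predU1P[<-|t0].
  by rewrite subr0 scale1r scale0r addr0.
move: t1; rewrite le_eqVlt => /predU1P[->|t1].
  by rewrite subrr scale1r scale0r add0r.
elim: fs fv fw => //= c fs IH; rewrite dotD !dotZ.
move=> [v0|[v0 fv]] [w0|[w0 fw]].
- by left; nra.
- by left; nra.
- by left; nra.
- by right; rewrite v0 w0 !mulr0 addr0; split => //; exact: IH.
Qed.

End means.

(** * The convex core *)

Section core.
Context {R : realType} {d : nat} (mu : probability (borelRn R d) R).
Hypothesis mu_mean : has_mean mu.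
Implicit Types (P : probability (borelRn R d) R).

Let m := signed_of_prob mu.

Let pm : probability_measures m.
Proof. by exists mu. Qed.

Lemma dominated_has_mean P : dominated m (signed_of_prob P) -> has_mean P.
Proof. by move=> Pm i; exact: dominated_integrable Pm (mu_mean i). Qed.

Lemma mean_set_conv (S : set (signed_measure (borelRn R d) R)) x y (t : R) :
  S `<=` dominated m -> convex_set (S : set (convex_lmodType _)) ->
  0 <= t <= 1 -> mean_set S x -> mean_set S y ->
  mean_set S ((1 - t) *: x + t *: y).
Proof.
move=> Sm /convex_setP cS t01 [P SP <-] [Q SQ <-].
have SPQ := cS _ _ t SP SQ t01.
have [[L _ LE] _] := Sm _ SPQ.
exists L; first by rewrite /= LE.
by apply: mean_conv => //; apply/dominated_has_mean/Sm.
Qed.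

(** A convex set of full measure carries [P]; if it missed the mean of [P], it would lie in a
    lexicographic cone at that mean, and the cone would contain its own apex. *)
Lemma mean_set_dominated_core : mean_set (dominated m) `<=` convex_core mu.
Proof.
move=> _ [P Pm <-] C [mC cC muC]; apply: contrapT => nC.
have [fs fsC] := convex_set_lexpos _ _ cC nC.
suff : lexpos fs (mean P - mean P) by rewrite subrr; exact: lexpos0.
apply: mean_lexpos; first exact: dominated_has_mean.
exists (~` C); split => [||x nx].
- exact: measurableC.
- have [_ [c c0 Pmu]] := Pm.
  move/signed_of_prob_leP : Pmu => /(_ (ltW c0)) Pmu.
  apply/eqP; rewrite -measure_le0 (le_trans (Pmu _ (measurableC mC)))//.
  by rewrite probability_setC// muC probability_setT subee// mule0.
- by move=> Cx; apply: nx; exact: fsC.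
Qed.

Lemma convex_coreE : convex_core mu = mean_set (dominated m).
Proof.
apply/seteqP; split; last exact: mean_set_dominated_core.
move=> x xcore; apply: contrapT => nMx.
have cM : convex_set (mean_set (dominated m) : set (convex_lmodType 'rV[R]_d)).
  apply/convex_setP => *; apply: mean_set_conv => //; exact: convex_dominated.
have [fs fsM] := convex_set_lexpos _ _ cM nMx.
pose C : set (borelRn R d) := [set y | lexpos fs ((y : 'rV[R]_d) - x)].
have mC : measurable C by exact: measurable_lexpos mu_mean.
have cC : convex_set (C : set (convex_lmodType 'rV[R]_d)).
  apply/convex_setP => y z t Cy Cz t01; rewrite /C /=.
  have -> : (1 - t) *: y + t *: z - x = (1 - t) *: (y - x) + t *: (z - x).
    by rewrite !scalerBr addrACA -opprD -scalerDl subrK scale1r.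
  exact: lexpos_conv.
have [C0|C0] := eqVneq (mu (~` C)) 0%E.
  have muC : mu C = mu setT.
    have -> : mu setT = (mu C + mu (~` C))%E.
      by rewrite -(setvU C) setUC; apply: measureU (setICr C) => //; exact: measurableC.
    by rewrite C0 adde0.
  (* A cone of full measure would have to contain the core point [x], its apex. *)
  have := xcore C; rewrite /C /= subrr => /(_ _)/lexpos0; apply.
  by split.
have [P Pm PC] := conditional_dominated _ _ _ _ _ (measurableC mC) C0.
have Pmean := dominated_has_mean _ Pm.
have : lexpos fs (mean P - x) by apply: fsM; exists P.
apply: mean_not_lexpos => //; exists C; split => //.
  by rewrite -[C]setCK.
by move=> y /contrapT.
Qed.

(** An interior point [x] lies between [mean mu] and some [mean Q]; the mixture of [Q] and [mu] with
    the same weights has mean [x] and dominates a positive multiple of [mu]. Conversely, [mean]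
    carries prolongations inside the face to prolongations of means. *)
Lemma mean_set_rel_algebraic_interior :
  rel_algebraic_interior (mean_set (dominated m)) = mean_set (equivalent m).
Proof.
have cdom := convex_dominated _ _ _ _ pm.
have cM : convex_set (mean_set (dominated m) : set (convex_lmodType 'rV[R]_d)).
  by apply/convex_setP => *; exact: mean_set_conv.
rewrite rel_algebraic_interiorE//; apply/seteqP; split=> x.
  move=> [_ xint].
  have [|e e0 [Q Qm QE]] := xint (mean mu).
    by exists mu => //; exact: dominated_refl.
  pose t := e / (1 + e).
  have e1 : 0 < 1 + e by exact: addr_gt0.
  have t01 : 0 <= t <= 1.
    by rewrite divr_ge0 ?(ltW e0) ?(ltW e1)//= ler_pdivrMr// mul1r lerDr.
  have dm := dominated_refl _ _ _ _ pm.
  have /convex_setP/(_ _ _ t Qm dm t01) Lm := cdom.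
  have [[L _ LE] _] := Lm.
  have Qmean := dominated_has_mean _ Qm.
  exists L; last first.
    by rewrite (mean_conv _ _ _ _ t01 LE)// QE; apply/esym/extrapolationP.
  split; first by rewrite LE.
  exists t^-1 => [|A]; first by rewrite invr_gt0 divr_gt0.
  rewrite LE signed_measureDE !signed_measureZE mulrDr.
  rewrite mulKf ?gt_eqF ?divr_gt0// lerDr.
  have [/probability_measuresP[Q0 _] _] := Qm.
  by rewrite mulr_ge0 ?invr_ge0 ?(andP t01).1// mulr_ge0// subr_ge0 (andP t01).2.
move=> [P Pm <-]; split; first by exists P => //; exact: Pm.1.
move=> _ [Q Qm <-].
have : rel_algebraic_interior (dominated m) (signed_of_prob P).
  by rewrite rel_algebraic_interior_dominated.
rewrite rel_algebraic_interiorE// => -[_ /(_ _ Qm)[e e0 Lm]].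
exists e => //; have [[L _ LE] _] := Lm; exists L; first by rewrite /= LE.
have e1 : 0 < 1 + e by exact: addr_gt0.
pose t := e / (1 + e).
have t01 : 0 <= t <= 1.
  by rewrite divr_ge0 ?(ltW e0) ?(ltW e1)//= ler_pdivrMr// mul1r lerDr.
have PE : signed_of_prob P = (1 - t) *: signed_of_prob L + t *: signed_of_prob Q.
  by apply/extrapolationP.
have Lmean : has_mean L by apply: dominated_has_mean; rewrite LE.
have Qmean := dominated_has_mean _ Qm.
by apply/esym/extrapolationP => //; exact: mean_conv PE Lmean Qmean.
Qed.

End core.

Theorem corollary10p2 (R : realType) (d : nat)
    (mu : probability (borelRn R d) R) (mu_mean : has_mean mu) :
  let F := face_generated (@probability_measures _ (borelRn R d) R)
             (signed_of_prob mu) in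
  let D : set (signed_measure (borelRn R d) R) :=
    [set signed_of_prob lambda | lambda in
      [set lambda : probability (borelRn R d) R |
        [/\ lambda `<< mu, mu `<< lambda &
            exists c : R, 1 < c /\
              {ae mu, forall x,
                ((c^-1)%:E <= ('d (charge_of_finite_measure lambda) '/d mu) x
                  <= c%:E)%E}]]] in
  [/\ have_means F, have_means (rel_algebraic_interior F) & have_means D] /\
  [/\ convex_core mu = mean_set F,
      rel_algebraic_interior (convex_core mu) =
        mean_set (rel_algebraic_interior F) &
      rel_algebraic_interior (convex_core mu) = mean_set D].
Proof.
move=> F D; have pm : probability_measures (signed_of_prob mu) by exists mu.
have DE : D = equivalent (signed_of_prob mu).
  apply/seteqP; split=> s.
    by move=> [la /= /equivalent_density la_mu <-].
  move=> smu; have [[[la _ laE] _] _] := smu.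
  by exists la => //=; apply/equivalent_density; rewrite laE.
rewrite /F DE face_generatedE// rel_algebraic_interior_dominated//.
rewrite convex_coreE// mean_set_rel_algebraic_interior//.
(* All three families lie in this face, whose members inherit integrability from [mu]. *)
have dom_means : have_means (dominated (signed_of_prob mu)).
  move=> s smu; have [[P _ PE] _] := smu; exists P => //=.
  by apply: (dominated_has_mean mu) => //; rewrite PE.
by split; split => //; apply: subset_trans dom_means => s [].
Qed.
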